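(* Let $f$ be an indefinite integral binary quadratic form of non-square discriminant. Under the labelling of the edges of the çark $\langle M_f\rangle\backslash\mathcal{F}$ by the forms of the class $[f]$, where the edge $\langle M_f\rangle\cdot\{W\}$ is labelled by $W\cdot f$, the reduced forms in the class $[f]$ are in one-to-one correspondence with the reduced edges of the çark.
   Context: Forms. $f=(A,B,C)$ denotes $f(x,y)=Ax^2+Bxy+Cy^2$ with $A,B,C\in\mathbf{Z}$, discriminant $\Delta=B^2-4AC$; it is indefinite if $\Delta>0$. $\mathrm{PSL}_2(\mathbf{Z})$ acts by $(U\cdot f)(x,y)=f(U(x,y)^t)$, and $[f]$ is the orbit of $f$. The stabilizer $\mathrm{Aut}(f)$ is infinite cyclic; let $M_f=\begin{pmatrix}p&q\\ r&s\end{pmatrix}$ be the generator of $\mathrm{Aut}(f)$ for which $\mathrm{sgn}(p+s)\,(r,s-p,-q)$ is a positive multiple of $f$. $M_f$ is hyperbolic. The form $f$ is reduced if (Gauss) $\bigl|\sqrt{\Delta}-2|A|\bigr|<B<\sqrt{\Delta}$. Çarks. Let $S(z)=-1/z$, $R(z)=(z-1)/z$. The bipartite Farey tree $\mathcal{F}$ has edges $\{W\}$, $\otimes$-vertices $\{W,WS\}$, $\bullet$-vertices $\{W,WR,WR^2\}$ ($W\in\mathrm{PSL}_2(\mathbf{Z})$); the edge $\{W\}$ joins $\{W,WS\}$ to $\{W,WR,WR^2\}$. $\mathrm{PSL}_2(\mathbf{Z})$ acts on it by left multiplication. $\mathcal{F}$ is realized in the upper half plane $\mathcal{H}$ as the $\mathrm{PSL}_2(\mathbf{Z})$-orbit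 of the geodesic arc (the edge $\{I\}$) from $i$ (the $\otimes$-vertex $\{I,S\}$) to $e^{i\pi/3}$ (the $\bullet$-vertex $\{I,R,R^2\}$). The quotient $\langle M_f\rangle\backslash\mathcal{F}$ is the çark of the class $[f]$; it is embedded in the annulus $\langle M_f\rangle\backslash\mathcal{H}$, and its unique circuit, the image of the axis of $M_f$ in $\mathcal{F}$, is its spine, directed by the translation direction of $M_f$. The annulus is viewed, compatibly with orientation, as a round annulus in the plane with the spine running counterclockwise, so the inner boundary component lies to the left of the directed spine and the outer one to the right. Each $\bullet$-vertex on the spine has two edges on the spine and one edge off the spine, from which an infinite Farey branch grows towards the inner or the outer boundary component. A maximal run of consecutive branches along the spine going towards the same boundary component is a Farey component. An edge of the spine is reduced if it is on either side of a Farey component in the direction of the inner boundary component; that is, it joins a $\bullet$-vertex $v$ of the spine whose branch goes to the inner boundary to a $\otimes$-vertex whose other neighbour on the spine is a $\bullet$-vertex whose branch goes to the outer boundary. *)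

(* Defs.v *)
From HB Require Import structures.
From mathcomp Require Import all_boot all_order all_algebra all_field.
From mathcomp Require Import ring.
From mathcomp Require Import boolp classical_sets functions.

Set Implicit Arguments.
Unset Strict Implicit.
Unset Printing Implicit Defensive.

Import Order.TTheory GRing.Theory Num.Theory.

Local Open Scope quotient_scope.
Local Open Scope classical_set_scope.
Local Open Scope ring_scope.

Record SL2Z := MkSL2Z { mx_of_SL2Z :> 'M[int]_2; _ : \det mx_of_SL2Z == 1 }.

HB.instance Definition _ := [isSub for mx_of_SL2Z].
HB.instance Definition _ := [Choice of SL2Z by <:].

Lemma det_SL2Z (A : SL2Z) : \det A = 1.
Proof. by apply/eqP; case: A. Qed.

Lemma SL2Z_unit (A : SL2Z) : (A : 'M[int]_2) \in unitmx.
Proof. by rewrite unitmxE det_SL2Z unitr1. Qed.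

Fact SL2Z_one_subproof : \det (1%:M : 'M[int]_2) == 1.
Proof. by rewrite det1. Qed.
Fact SL2Z_mul_subproof (A B : SL2Z) : \det (A *m B) == 1.
Proof. by rewrite det_mulmx !det_SL2Z mulr1. Qed.
Fact SL2Z_inv_subproof (A : SL2Z) : \det (invmx A) == 1.
Proof. by rewrite det_inv det_SL2Z invr1. Qed.

Definition SL2Z_one := MkSL2Z SL2Z_one_subproof.
Definition SL2Z_mul A B := MkSL2Z (SL2Z_mul_subproof A B).
Definition SL2Z_inv A := MkSL2Z (SL2Z_inv_subproof A).

Fact SL2Z_mulA : associative SL2Z_mul.
Proof. by move=> A B C; apply: val_inj; rewrite /= mulmxA. Qed.
Fact SL2Z_mul1 : left_id SL2Z_one SL2Z_mul.
Proof. by move=> A; apply: val_inj; rewrite /= mul1mx. Qed.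
Fact SL2Z_1mul : right_id SL2Z_one SL2Z_mul.
Proof. by move=> A; apply: val_inj; rewrite /= mulmx1. Qed.
Fact SL2Z_mulV : left_inverse SL2Z_one SL2Z_inv SL2Z_mul.
Proof. by move=> A; apply: val_inj; rewrite /= mulVmx ?SL2Z_unit. Qed.
Fact SL2Z_Vmul : right_inverse SL2Z_one SL2Z_inv SL2Z_mul.
Proof. by move=> A; apply: val_inj; rewrite /= mulmxV ?SL2Z_unit. Qed.

HB.instance Definition _ :=
  isGroup.Build SL2Z SL2Z_mulA SL2Z_mul1 SL2Z_1mul SL2Z_mulV SL2Z_Vmul.

Definition eq_sign (A B : SL2Z) : bool :=
  (A == B :> 'M[int]_2) || (A == - (B : 'M[int]_2) :> 'M[int]_2).

Fact eq_sign_refl : reflexive eq_sign.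
Proof. by move=> A; rewrite /eq_sign eqxx. Qed.
Fact eq_sign_sym : symmetric eq_sign.
Proof.
move=> A B; rewrite /eq_sign eq_sym; congr (_ || _).
by rewrite -eqr_oppLR eq_sym.
Qed.
Fact eq_sign_trans : transitive eq_sign.
Proof.
move=> B A C; rewrite /eq_sign => /orP[]/eqP-> /orP[]/eqP->;
  by rewrite ?opprK eqxx ?orbT.
Qed.

Canonical eq_sign_equiv := EquivRel eq_sign eq_sign_refl eq_sign_sym eq_sign_trans.

Definition PSL2Z := {eq_quot eq_sign}.
HB.instance Definition _ := EqQuotient.on PSL2Z.
HB.instance Definition _ := Choice.on PSL2Z.

Lemma eq_PSL2Z (A B : SL2Z) : \pi_PSL2Z A = \pi_PSL2Z B <-> eq_sign A B.
Proof. by split=> [/eqmodP|] // h; apply/eqmodP. Qed.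

Lemma repr_PSL2Z (A : SL2Z) : eq_sign (repr (\pi_PSL2Z A)) A.
Proof. by apply/eq_PSL2Z; rewrite reprK. Qed.

Definition PSL2Z_one : PSL2Z := \pi_PSL2Z 1%g.
Definition PSL2Z_mul (U V : PSL2Z) : PSL2Z := \pi_PSL2Z (repr U * repr V)%g.
Definition PSL2Z_inv (U : PSL2Z) : PSL2Z := \pi_PSL2Z (repr U)^-1%g.

Lemma PSL2Z_mulE (A B : SL2Z) :
  PSL2Z_mul (\pi_PSL2Z A) (\pi_PSL2Z B) = \pi_PSL2Z (A * B)%g.
Proof.
apply/eq_PSL2Z; rewrite /eq_sign /=.
by case/orP: (repr_PSL2Z A) => /eqP->; case/orP: (repr_PSL2Z B) => /eqP->;
  rewrite ?mulNmx ?mulmxN ?opprK eqxx ?orbT.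
Qed.

Lemma PSL2Z_invE (A : SL2Z) : PSL2Z_inv (\pi_PSL2Z A) = \pi_PSL2Z A^-1%g.
Proof.
apply/eq_PSL2Z; rewrite /eq_sign /=.
case/orP: (repr_PSL2Z A) => /eqP->; rewrite ?eqxx //.
have UN : -1 *: (A : 'M[int]_2) \in unitmx.
  by rewrite unitmxZ ?unitrN1 ?SL2Z_unit.
by rewrite -scaleN1r (invmxZ UN) invrN1 scaleN1r eqxx orbT.
Qed.

Fact PSL2Z_mulA : associative PSL2Z_mul.
Proof.
move=> U V W; rewrite -(reprK U) -(reprK V) -(reprK W).
by rewrite (PSL2Z_mulE (repr V) (repr W)) (PSL2Z_mulE (repr U) (repr V))
  PSL2Z_mulE (PSL2Z_mulE (repr U * repr V)%g) mulgA.
Qed.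
Fact PSL2Z_mul1 : left_id PSL2Z_one PSL2Z_mul.
Proof. by move=> U; rewrite -(reprK U) PSL2Z_mulE mul1g. Qed.
Fact PSL2Z_1mul : right_id PSL2Z_one PSL2Z_mul.
Proof. by move=> U; rewrite -(reprK U) PSL2Z_mulE mulg1. Qed.
Fact PSL2Z_mulV : left_inverse PSL2Z_one PSL2Z_inv PSL2Z_mul.
Proof. by move=> U; rewrite -(reprK U) PSL2Z_invE PSL2Z_mulE mulVg. Qed.
Fact PSL2Z_Vmul : right_inverse PSL2Z_one PSL2Z_inv PSL2Z_mul.
Proof. by move=> U; rewrite -(reprK U) PSL2Z_invE PSL2Z_mulE mulgV. Qed.

HB.instance Definition _ :=
  isGroup.Build PSL2Z PSL2Z_mulA PSL2Z_mul1 PSL2Z_1mul PSL2Z_mulV PSL2Z_Vmul.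

Definition mx2 (p q r s : int) : 'M[int]_2 :=
  \matrix_(i, j) if i == 0 then (if j == 0 then p else q)
                 else (if j == 0 then r else s).

Lemma det_mx2 p q r s : \det (mx2 p q r s) = p * s - q * r.
Proof.
rewrite (expand_det_row _ ord0) !big_ord_recl big_ord0 /cofactor !det_mx11.
by rewrite !mxE /=; ring.
Qed.

Fact Smx_subproof : \det (mx2 0 (-1) 1 0) == 1.
Proof. by rewrite det_mx2. Qed.
Fact Rmx_subproof : \det (mx2 1 (-1) 1 0) == 1.
Proof. by rewrite det_mx2. Qed.

(* z |-> -1/z and z |-> (z-1)/z *)
Definition genS : PSL2Z := \pi_PSL2Z (MkSL2Z Smx_subproof).
Definition genR : PSL2Z := \pi_PSL2Z (MkSL2Z Rmx_subproof).

Definition cyclic_subgroup (M : PSL2Z) : set PSL2Z :=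
  [set N | exists n : nat, (N = M ^+ n \/ N = M ^- n)%g].

Record qform := QForm { qa : int; qb : int; qc : int }.

Definition qeval (f : qform) (x y : int) : int :=
  qa f * x ^+ 2 + qb f * x * y + qc f * y ^+ 2.

Definition disc (f : qform) : int := qb f ^+ 2 - 4 * qa f * qc f.

Definition act_mx (U : 'M[int]_2) (f : qform) : qform :=
  let p := U 0 0 in let q := U 0 1 in let r := U 1 0 in let s := U 1 1 in
  QForm (qa f * p ^+ 2 + qb f * p * r + qc f * r ^+ 2)
        (2 * qa f * p * q + qb f * (p * s + q * r) + 2 * qc f * r * s)
        (qa f * q ^+ 2 + qb f * q * s + qc f * s ^+ 2).

Lemma act_mxE U f x y :
  qeval (act_mx U f) x y =
  qeval f (U 0 0 * x + U 0 1 * y) (U 1 0 * x + U 1 1 * y).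
Proof. by rewrite /qeval /act_mx /=; ring. Qed.

(* This composes contravariantly: act (U * V) f = act V (act U f). Hence
   W |-> act W f is constant on the cosets <M> W when M fixes f. *)
Definition act (U : PSL2Z) (f : qform) : qform := act_mx (repr U) f.

Lemma act_pi (A : SL2Z) f : act (\pi_PSL2Z A) f = act_mx A f.
Proof.
rewrite /act; case/orP: (repr_PSL2Z A) => /eqP-> //.
by rewrite /act_mx !mxE; congr QForm; rewrite ?sqrrN ?mulrNN ?mulrN ?mulNr ?opprK.
Qed.

Definition qclass (f : qform) : set qform := [set act U f | U in [set: PSL2Z]].

Definition Aut (f : qform) : set PSL2Z := [set U | act U f = f].

(* The positive multiple is allowed to be rational, since f need not be
   primitive. The condition does not depend on the sign of the representative. *)
Definition is_Mf (f : qform) (M : PSL2Z) : Prop :=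
  Aut f = cyclic_subgroup M /\
  let p := repr M 0 0 in let q := repr M 0 1 in
  let r := repr M 1 0 in let s := repr M 1 1 in
  exists2 k : rat, 0 < k &
    [/\ (Num.sg (p + s) * r)%:~R = k * (qa f)%:~R,
        (Num.sg (p + s) * (s - p))%:~R = k * (qb f)%:~R
      & (Num.sg (p + s) * (- q))%:~R = k * (qc f)%:~R].

Definition gauss_reduced (f : qform) : Prop :=
  let sqrtD : algC := sqrtC (disc f)%:~R in
  `|sqrtD - 2 * `|(qa f)%:~R| | < (qb f)%:~R < sqrtD.

(* The edge {W} of the Farey tree is encoded by W itself; it joins the
   vertices [otimes W] and [bullet W]. *)
Definition otimes (W : PSL2Z) : set PSL2Z := [set W; (W * genS)%g].
Definition bullet (W : PSL2Z) : set PSL2Z :=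
  [set W; (W * genR)%g; (W * genR ^+ 2)%g].

(* The tangent direction, at its bullet-end W(rho), of the realization in the
   upper half plane of the edge {W}. For W = I the edge is the arc of the unit
   circle from rho = exp(i pi / 3) to 'i, which leaves rho in the direction
   'i * rho; and (p z + q) / (r z + s) has derivative 1 / (r z + s) ^ 2. *)
Definition rho : algC := (1 + 'i * sqrtC 3) / 2.
Definition edge_dir (W : PSL2Z) : algC :=
  'i * rho / ((repr W 1 0)%:~R * rho + (repr W 1 1)%:~R) ^+ 2.

Lemma edge_dir_pi (A : SL2Z) :
  edge_dir (\pi_PSL2Z A) = 'i * rho / ((A 1 0)%:~R * rho + (A 1 1)%:~R) ^+ 2.
Proof.
rewrite /edge_dir; case/orP: (repr_PSL2Z A) => /eqP-> //.
by rewrite !mxE !rmorphN mulNr -opprD sqrrN.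
Qed.

(* [e] runs along the axis of [M] in its translation direction. The parity is a
   normalization: the line enters a bullet-vertex through [e (2 * n)] and leaves
   it through [e (2 * n + 1)]. *)
Record directed_axis (M : PSL2Z) (e : int -> PSL2Z) : Prop := {
  axis_inj : injective e;
  axis_bullet : forall n, bullet (e (2 * n)) = bullet (e (2 * n + 1));
  axis_otimes : forall n, otimes (e (2 * n + 1)) = otimes (e (2 * n + 2));
  axis_transl : exists2 l : int, 0 < l & forall n, (M * e n)%g = e (n + l)
}.

(* The edges and vertices of the cark, i.e. of the quotient graph of the Farey
   tree by <M>, are the <M>-orbits of edges and vertices of the tree. *)
Definition cark_edge (M W : PSL2Z) : set PSL2Z := [set (N * W)%g | N in cyclic_subgroup M].
Definition cark_vertex (M : PSL2Z) (v : set PSL2Z) : set (set PSL2Z) :=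
  [set [set (N * W)%g | W in v] | N in cyclic_subgroup M].

Definition joins (M : PSL2Z) (E : set PSL2Z) (t v : set (set PSL2Z)) : Prop :=
  exists W, [/\ E = cark_edge M W, t = cark_vertex M (otimes W)
              & v = cark_vertex M (bullet W)].

Definition spine_edge (M : PSL2Z) (E : set PSL2Z) : Prop :=
  exists e n, directed_axis M e /\ E = cark_edge M (e n).

(* The bullet-vertex v lies on the spine, X is the edge through which a lift of
   the directed spine leaves (a lift of) v, and Z is the edge off the spine
   there, from which the Farey branch of v grows. *)
Definition branch_at (M : PSL2Z) (v : set (set PSL2Z)) (X Z : PSL2Z) : Prop :=
  exists e n,
    [/\ directed_axis M e, v = cark_vertex M (bullet (e (2 * n))),
        X = e (2 * n + 1)
      & [/\ bullet (e (2 * n)) Z, Z <> e (2 * n) & Z <> e (2 * n + 1)]].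

(* The inner boundary is to the left of the directed spine. The edges at a
   bullet-vertex meet at angles 2 pi / 3, so the branch is on the left when its
   direction is obtained from the outgoing one by a positive rotation of angle
   less than pi, and on the right when the rotation is negative. As the tree is
   embedded, a branch stays on the side of the spine on which it leaves it. *)
Definition branch_inner (M : PSL2Z) (v : set (set PSL2Z)) : Prop :=
  exists X Z, branch_at M v X Z /\ 0 < 'Im (edge_dir Z / edge_dir X).
Definition branch_outer (M : PSL2Z) (v : set (set PSL2Z)) : Prop :=
  exists X Z, branch_at M v X Z /\ 'Im (edge_dir Z / edge_dir X) < 0.

Definition reduced_edge (M : PSL2Z) (E : set PSL2Z) : Prop :=
  spine_edge M E /\
  exists t v E' v',
    [/\ joins M E t v, branch_inner M v,
        spine_edge M E' /\ E' <> E, joins M E' t v' & branch_outer M v'].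

(* Main.v *)
(** Write [g = (a, b, c)] for the form [act W f] labelling the edge [W]. The
   edge lies on the axis of [M] iff [a * c < 0]; the axis is then read off from
   [g] as a cutting sequence: at an edge with [a > 0 > c] the next one is
   obtained by right multiplication by [T = (1 1; 0 1)] or [L = (1 0; 1 1)],
   according to the sign of [g(1,1) = a + b + c], and these two cases are those
   of a branch on the right, resp. on the left. Since [W^-1 M W] is a nonnegative
   matrix, it is the product of finitely many of these turns, which makes the
   resulting line [M]-invariant. Applied to [W] and to [W S] this shows that [W]
   is reduced iff [a * c < 0], [a + b + c > 0] and [a - b + c < 0], that is
   [a * c < 0] and [b > |a + c|], which is Gauss' condition. *)
Require Import Defs.
From mathcomp Require Import all_boot all_order all_algebra all_field.
From mathcomp Require Import zify ring.
From mathcomp Require Import boolp classical_sets functions.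
Set Implicit Arguments.
Unset Strict Implicit.
Unset Printing Implicit Defensive.

Import Order.TTheory GRing.Theory Num.Theory.
Local Open Scope quotient_scope.
Local Open Scope classical_set_scope.
Local Open Scope ring_scope.

(** * Matrix entries and the action on forms *)

Lemma mulmx2E (R : pzRingType) (A B : 'M[R]_2) i j :
  (A *m B) i j = A i 0 * B 0 j + A i 1 * B 1 j.
Proof.
rewrite mxE !big_ord_recl big_ord0 addr0.
by congr (_ + A i _ * B _ j); apply: val_inj.
Qed.

Lemma eq_mx2P (R : Type) (A B : 'M[R]_2) :
  A 0 0 = B 0 0 -> A 0 1 = B 0 1 -> A 1 0 = B 1 0 -> A 1 1 = B 1 1 -> A = B.
Proof.
move=> e00 e01 e10 e11; apply/matrixP => i j.
have ord2 (k : 'I_2) : k = 0 \/ k = 1.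
  by case: k => [[|[|//]] ?]; [left|right]; apply: val_inj.
by case: (ord2 i) => ->; case: (ord2 j) => ->.
Qed.

Lemma det_SL2ZE (A : SL2Z) : A 0 0 * A 1 1 - A 0 1 * A 1 0 = 1.
Proof.
rewrite -(det_SL2Z A) -det_mx2; congr (\det _).
by apply: eq_mx2P; rewrite !mxE.
Qed.

Lemma act_mxM (A B : 'M[int]_2) f : act_mx (A *m B) f = act_mx B (act_mx A f).
Proof. by rewrite /act_mx !mulmx2E /=; congr QForm; ring. Qed.

Lemma mx_of_SL2ZM (A B : SL2Z) : (A * B)%g = A *m B :> 'M[int]_2.
Proof. by []. Qed.

Lemma pi_mulg (A B : SL2Z) :
  (\pi_PSL2Z A * \pi_PSL2Z B)%g = \pi_PSL2Z (A * B)%g.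
Proof. exact: PSL2Z_mulE. Qed.

Lemma actM U V f : act (U * V)%g f = act V (act U f).
Proof.
by rewrite -(reprK U) -(reprK V) pi_mulg !act_pi -act_mxM.
Qed.

Lemma act1 f : act 1%g f = f.
Proof.
case: f => a b c; rewrite (act_pi 1%g) /act_mx !mxE /=.
by congr QForm; ring.
Qed.

Lemma actKV U f : act U^-1%g (act U f) = f.
Proof. by rewrite -actM mulgV act1. Qed.

Lemma act_genS f : act genS f = QForm (qc f) (- qb f) (qa f).
Proof. by rewrite act_pi /act_mx !mxE /=; congr QForm; ring. Qed.

Lemma act_genR f :
  act genR f = QForm (qa f + qb f + qc f) (- 2 * qa f - qb f) (qa f).
Proof. by rewrite act_pi /act_mx !mxE /=; congr QForm; ring. Qed.

Lemma disc_act U f : disc (act U f) = disc f.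
Proof.
rewrite -(reprK U) act_pi /disc /act_mx /=; set A := repr U.
have -> : qb f ^+ 2 - 4 * qa f * qc f =
    (A 0 0 * A 1 1 - A 0 1 * A 1 0) ^+ 2 * (qb f ^+ 2 - 4 * qa f * qc f).
  by rewrite det_SL2ZE expr1n mul1r.
ring.
Qed.

Lemma eq_pi_mxP (A B : SL2Z) :
  [/\ A 0 0 = B 0 0, A 0 1 = B 0 1, A 1 0 = B 1 0 & A 1 1 = B 1 1] \/
  [/\ A 0 0 = - B 0 0, A 0 1 = - B 0 1, A 1 0 = - B 1 0 & A 1 1 = - B 1 1] <->
  \pi_PSL2Z A = \pi_PSL2Z B.
Proof.
split=> [h|/eq_PSL2Z/orP[]/eqP->]; last 2 first.
- by left.
- by right; rewrite !mxE.
apply/eq_PSL2Z/orP; case: h => -[? ? ? ?]; [left|right]; apply/eqP.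
  exact: eq_mx2P.
by apply: eq_mx2P; rewrite !mxE.
Qed.

(** * The generators of the modular group and the turns [T] and [L] *)

Lemma genSS : (genS * genS = 1)%g.
Proof.
rewrite /genS pi_mulg; apply/eq_pi_mxP; right.
by rewrite !mx_of_SL2ZM !mulmx2E !mxE.
Qed.

Lemma genRRR : (genR * genR * genR = 1)%g.
Proof.
rewrite /genR !pi_mulg; apply/eq_pi_mxP; right.
by rewrite !mx_of_SL2ZM !mulmx2E !mxE.
Qed.

Lemma genSK W : (W * genS * genS = W)%g.
Proof. by rewrite -mulgA genSS mulg1. Qed.

Lemma genRK W : (W * genR * genR * genR = W)%g.
Proof. by rewrite -!mulgA (mulgA genR) genRRR mulg1. Qed.

Fact Tmx_subproof : \det (mx2 1 1 0 1) == 1.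
Proof. by rewrite det_mx2. Qed.
Fact Lmx_subproof : \det (mx2 1 0 1 1) == 1.
Proof. by rewrite det_mx2. Qed.
Definition Tmx := MkSL2Z Tmx_subproof.
Definition Lmx := MkSL2Z Lmx_subproof.
Definition genT : PSL2Z := (genR * genS)%g.
Definition genL : PSL2Z := (genR * genR * genS)%g.

Lemma genTE : genT = \pi_PSL2Z Tmx.
Proof.
rewrite /genT /genR /genS pi_mulg; apply/eq_pi_mxP; right.
by rewrite !mx_of_SL2ZM !mulmx2E !mxE.
Qed.

Lemma genLE : genL = \pi_PSL2Z Lmx.
Proof.
rewrite /genL /genR /genS !pi_mulg; apply/eq_pi_mxP; right.
by rewrite !mx_of_SL2ZM !mulmx2E !mxE.
Qed.

Lemma act_genT f :
  act genT f = QForm (qa f) (2 * qa f + qb f) (qa f + qb f + qc f).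
Proof. by rewrite actM act_genS act_genR /=; congr QForm; ring. Qed.

Lemma act_genL f :
  act genL f = QForm (qa f + qb f + qc f) (qb f + 2 * qc f) (qc f).
Proof. by rewrite !actM act_genS !act_genR /=; congr QForm; ring. Qed.

(* This is the form v |-> det(v, A v), whence its equivariance. *)
Definition fix_form (A : 'M[int]_2) : qform :=
  QForm (A 1 0) (A 1 1 - A 0 0) (- A 0 1).

Lemma fix_form_conj (A B U : 'M[int]_2) : \det U = 1 -> U *m B = A *m U ->
  fix_form B = act_mx U (fix_form A) /\ B 0 0 + B 1 1 = A 0 0 + A 1 1.
Proof.
move=> dU; have {}dU : U 0 0 * U 1 1 - U 0 1 * U 1 0 = 1.
  by rewrite -dU -det_mx2; congr (\det _); apply: eq_mx2P; rewrite !mxE.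
set adjU := mx2 (U 1 1) (- U 0 1) (- U 1 0) (U 0 0).
have adjUK : adjU *m U = 1%:M.
  by apply: eq_mx2P; rewrite mulmx2E !mxE /= -?dU; ring.
move=> e; have -> : B = adjU *m (A *m U) by rewrite -e mulmxA adjUK mul1mx.
split.
  by rewrite /fix_form /act_mx !mulmx2E !mxE /=; congr QForm; ring.
by rewrite !mulmx2E !mxE /= -[RHS]mul1r -dU; ring.
Qed.

(** * Directions of the edges at a bullet-vertex *)

Lemma rho_sqr : rho ^+ 2 = rho - 1.
Proof.
have -> : rho ^+ 2 = (1 + 2 * ('i * sqrtC 3) + 'i ^+ 2 * sqrtC 3 ^+ 2) / 4.
  by rewrite /rho; field.
by rewrite sqrCi sqrtCK /rho; field.
Qed.

Lemma Im_rho_gt0 : 0 < 'Im rho.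
Proof.
have s3 : 0 < sqrtC 3 / 2 :> algC by rewrite divr_gt0 // sqrtC_gt0.
have -> : rho = (1 / 2) + 'i * (sqrtC 3 / 2) by rewrite /rho; field.
by rewrite Im_rect //; apply: ger0_real; [rewrite divr_ge0|exact: ltW].
Qed.

Lemma rho_neq0 : rho != 0.
Proof. by apply: contraTneq Im_rho_gt0 => ->; rewrite raddf0 ltxx. Qed.

Lemma edge_den_neq0 (A : SL2Z) : (A 1 0)%:~R * rho + (A 1 1)%:~R != 0.
Proof.
apply/eqP => e; have /eqP := congr1 (@Im _) e.
rewrite raddf0 raddfD /= (ImMl (realz _ _)) (Creal_ImP _ (realz _ _)) addr0.
rewrite mulf_eq0 (gt_eqF Im_rho_gt0) orbF intr_eq0 => /eqP r0.
move: e; rewrite r0 mul0r add0r => /eqP; rewrite intr_eq0 => /eqP s0.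
by have := det_SL2ZE A; rewrite r0 s0 !mulr0; lia.
Qed.

Lemma edge_dir_neq0 X : edge_dir X != 0.
Proof.
by rewrite -(reprK X) edge_dir_pi mulf_neq0 ?invr_neq0 ?expf_neq0 ?edge_den_neq0 //
  mulf_neq0 ?neq0Ci ?rho_neq0.
Qed.

(** The map [R] fixes [rho] and has derivative [1 / rho ^ 2 = - rho] there, a clockwise rotation by
    [2 pi / 3]. *)
Lemma edge_dirR X : edge_dir (X * genR)%g = - rho * edge_dir X.
Proof.
rewrite -(reprK X) /genR pi_mulg !edge_dir_pi mx_of_SL2ZM !mulmx2E !mxE /=.
set r := repr X 1 0; set s := repr X 1 1.
have D0 : r%:~R * rho + s%:~R != 0 by exact: edge_den_neq0.
have -> : (r * 1 + s * 1)%:~R * rho + (r * -1 + s * 0)%:~R =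
    rho * (r%:~R * rho + s%:~R).
  have -> : rho * (r%:~R * rho + s%:~R) = r%:~R * rho ^+ 2 + s%:~R * rho by ring.
  by rewrite rho_sqr; ring.
have rho3 : rho ^+ 3 = -1 by rewrite exprS rho_sqr mulrBr -expr2 rho_sqr; ring.
set D := _ + _ in D0 *.
transitivity (- rho ^+ 3 * ('i * rho / (rho * D) ^+ 2)).
  by rewrite rho3 opprK mul1r.
by field; rewrite D0 rho_neq0.
Qed.

Lemma edge_dirR_right X : 'Im (edge_dir (X * genR)%g / edge_dir X) < 0.
Proof. by rewrite edge_dirR mulfK ?edge_dir_neq0 // raddfN oppr_lt0 Im_rho_gt0. Qed.

Lemma edge_dirRR_left X : 0 < 'Im (edge_dir (X * genR * genR)%g / edge_dir X).
Proof.
rewrite !edge_dirR mulrA mulfK ?edge_dir_neq0 // mulrNN -expr2 rho_sqr raddfB /=.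
by rewrite (Creal_ImP _ (rpred1 _)) subr0 Im_rho_gt0.
Qed.

(** These are the values of [g] at [(1,0)], [(0,1)] and [(1,1)]; a zero among them would make the
    discriminant a square. *)
Lemma nonsquare_coef g : ~ (exists n : int, disc g = n ^+ 2) ->
  [/\ qa g <> 0, qc g <> 0 & qa g + qb g + qc g <> 0].
Proof.
rewrite /disc => nsq; split=> e; apply: nsq.
- by exists (qb g); rewrite e; ring.
- by exists (qb g); rewrite e; ring.
exists (2 * qa g + qb g).
by have -> : qc g = - qa g - qb g; [lia|ring].
Qed.

(** * Nonnegative matrices and words of turns *)

Definition nneg_mx (A : 'M[int]_2) : Prop :=
  [/\ 0 <= A 0 0, 0 <= A 0 1, 0 <= A 1 0 & 0 <= A 1 1].

(** Every turn increases it strictly, so it bounds the length of a word of turns. *)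
Definition sum_mx (A : 'M[int]_2) : int := A 0 0 + A 0 1 + A 1 0 + A 1 1.

Lemma nneg_mx_diag (A : SL2Z) : nneg_mx A -> 0 < A 0 0 /\ 0 < A 1 1.
Proof. by case; move: (det_SL2ZE A) => *; split; nia. Qed.

Lemma nneg_mxT (A : SL2Z) : nneg_mx A ->
  nneg_mx (A * Tmx)%g /\ sum_mx A < sum_mx (A * Tmx)%g.
Proof.
move=> nA; have [p0 s0] := nneg_mx_diag nA; case: nA => *.
by rewrite /nneg_mx /sum_mx mx_of_SL2ZM !mulmx2E !mxE /=; split; [split|]; lia.
Qed.

Lemma nneg_mxL (A : SL2Z) : nneg_mx A ->
  nneg_mx (A * Lmx)%g /\ sum_mx A < sum_mx (A * Lmx)%g.
Proof.
move=> nA; have [p0 s0] := nneg_mx_diag nA; case: nA => *.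
by rewrite /nneg_mx /sum_mx mx_of_SL2ZM !mulmx2E !mxE /=; split; [split|]; lia.
Qed.

Definition turn (U V : PSL2Z) : Prop := V = (U * genT)%g \/ V = (U * genL)%g.

Lemma turn_word (e : nat -> PSL2Z) n : (forall k, turn (e k) (e k.+1)) ->
  exists A : SL2Z, [/\ e n = (e 0%N * \pi_PSL2Z A)%g, nneg_mx A
                     & n%:Z + 2 <= sum_mx A].
Proof.
move=> te; elim: n => [|n [A [eA nA sA]]].
  exists 1%g; split; first by rewrite mulg1.
    by split; rewrite !mxE.
  by rewrite /sum_mx !mxE.
have [nT lT] := nneg_mxT nA; have [nL lL] := nneg_mxL nA.
case: (te n) => ->; rewrite eA -mulgA ?genTE ?genLE pi_mulg.
  by exists (A * Tmx)%g; split=> //; lia.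
by exists (A * Lmx)%g; split=> //; lia.
Qed.

(** A return forces the word to be plus or minus the identity, whose entry sum is at most [2]. *)
Lemma turn_no_return (e : nat -> PSL2Z) n : (forall k, turn (e k) (e k.+1)) ->
  e n = e 0%N -> n = 0%N.
Proof.
move=> te en; have [A [eA nA sA]] := turn_word n te.
have /eq_pi_mxP : \pi_PSL2Z A = \pi_PSL2Z 1%g.
  by apply: (mulgI (e 0%N)); rewrite -eA mulg1.
move: sA; rewrite /sum_mx !mxE /= => sA [] [*]; lia.
Qed.

(** * Signs of the labels and of the conjugates of [M] *)

Section Form.

Variables (f : qform) (M : PSL2Z).
Hypothesis f_nonsq : ~ exists n : int, disc f = n ^+ 2.
Hypothesis hM : is_Mf f M.

Lemma cyclicE N : cyclic_subgroup M N <-> act N f = f.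
Proof. by case: hM => eM _; rewrite -eM. Qed.

Lemma act_Mf : act M f = f.
Proof. by apply/cyclicE; exists 1%N; left. Qed.

Lemma nonsquare_act W : let g := act W f in
  [/\ qa g <> 0, qc g <> 0 & qa g + qb g + qc g <> 0].
Proof. by apply: nonsquare_coef; rewrite disc_act. Qed.

(** Transports the normalization of [is_Mf] from the edge [I] to the edge [W]. The quotient [n / m]
    is the rational factor given there, hence the same for all [W]. *)
Lemma fix_form_pos : exists m n : int, [/\ 0 < m, 0 < n &
  forall W (B : SL2Z), \pi_PSL2Z B = (W^-1 * M * W)%g ->
  m * (Num.sg (B 0 0 + B 1 1) * B 1 0) = n * qa (act W f) /\
  m * (Num.sg (B 0 0 + B 1 1) * - B 0 1) = n * qc (act W f)].
Proof.
case: hM => _ [k k0 [ka kb kc]].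
have kE : k = (numq k)%:~R / (denq k)%:~R by rewrite divq_num_den.
have int_eq (x y : int) : x%:~R = k * y%:~R -> denq k * x = numq k * y.
  move=> e; apply: (@intr_inj rat); rewrite !rmorphM /= e [in k * _]kE.
  by field; rewrite intr_eq0 denq_eq0.
move: {ka kb kc kE} (int_eq _ _ ka) (int_eq _ _ kb) (int_eq _ _ kc) => ka kb kc.
exists (denq k), (numq k); split=> //; first by rewrite numq_gt0.
move=> W B eB.
set A := repr M in ka kb kc; set U := repr W.
have /eq_PSL2Z : \pi_PSL2Z (U * B)%g = \pi_PSL2Z (A * U)%g.
  by rewrite -!pi_mulg !reprK eB !mulgA mulgV mul1g.
rewrite /eq_sign => H.
have : exists B' : 'M[int]_2, U *m B' = A *m U /\
    (B' = B \/ B' = - (B : 'M[int]_2)).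
  case/orP: H => /eqP; rewrite !mx_of_SL2ZM => e.
    by exists B; split=> //; left.
  by exists (- (B : 'M[int]_2)); split; [rewrite mulmxN e opprK|right].
case=> B' [/fix_form_conj-/(_ (det_SL2Z U))[eB' tB'] sB'].
have -> : act W f = act_mx U f by [].
move: eB' => /(congr1 (fun g => (qa g, qc g)))/=[ra rc].
(* Passing to [- B] changes the sign of both the trace and the entry, so the product is well
   defined. *)
have {}sB' : Num.sg (B 0 0 + B 1 1) * B 1 0 = Num.sg (B' 0 0 + B' 1 1) * B' 1 0
  /\ Num.sg (B 0 0 + B 1 1) * - B 0 1 = Num.sg (B' 0 0 + B' 1 1) * - B' 0 1.
  by case: sB' => ->; rewrite ?mxE // -opprD sgrN; split; ring.
rewrite /= !sB'.1 !sB'.2 tB' ra rc; set s := Num.sg _.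
split.
  transitivity (denq k * (s * A 1 0) * U 0 0 ^+ 2
    + denq k * (s * (A 1 1 - A 0 0)) * U 0 0 * U 1 0
    + denq k * (s * - A 0 1) * U 1 0 ^+ 2); first by ring.
  by rewrite ka kb kc; ring.
transitivity (denq k * (s * A 1 0) * U 0 1 ^+ 2
  + denq k * (s * (A 1 1 - A 0 0)) * U 0 1 * U 1 1
  + denq k * (s * - A 0 1) * U 1 1 ^+ 2); first by ring.
by rewrite ka kb kc; ring.
Qed.

(* This characterizes the edges [e (2 * n)] of a directed axis [e]. *)
Definition forward (W : PSL2Z) : Prop :=
  0 < qa (act W f) /\ qc (act W f) < 0.

(** The signs of the off-diagonal entries pass to the outer coefficients of the label, which are
    nonzero. *)
Lemma nneg_mx_forward W (B : SL2Z) : \pi_PSL2Z B = (W^-1 * M * W)%g ->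
  nneg_mx B -> forward W.
Proof.
have [m [n [m0 n0 h]]] := fix_form_pos => /h[ea ec] nB.
have [p0 s0] := nneg_mx_diag nB; case: nB => *.
have [na nc _] := nonsquare_act W; rewrite /forward.
by move: ea ec; rewrite (gtr0_sg (addr_gt0 p0 s0)) !mul1r => *; split; nia.
Qed.

Lemma trace_ge0_repr (V : PSL2Z) :
  exists B : SL2Z, \pi_PSL2Z B = V /\ 0 <= B 0 0 + B 1 1.
Proof.
have [t0|t0] := leP 0 (repr V 0 0 + repr V 1 1).
  by exists (repr V); rewrite reprK.
have dN : \det (- (repr V : 'M[int]_2)) == 1.
  by rewrite -scaleN1r detZ det_SL2Z.
exists (MkSL2Z dN); split; last by rewrite /= !mxE -opprD oppr_ge0 ltW.
by rewrite -[RHS]reprK; apply/eq_pi_mxP; right; rewrite /= !mxE.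
Qed.

(** Converse of [nneg_mx_forward]: with nonnegative trace chosen, the off-diagonal entries are
    positive, so the diagonal ones have positive product and sum. *)
Lemma forward_nneg_mx W : forward W ->
  exists B : SL2Z, [/\ \pi_PSL2Z B = (W^-1 * M * W)%g, nneg_mx B & 0 < B 1 0].
Proof.
have [m [n [m0 n0 h]]] := fix_form_pos => -[a0 c0].
have [B [eB tB]] := trace_ge0_repr (W^-1 * M * W)%g.
have [ea ec] := h W B eB.
move: ea ec tB; rewrite le_eqVlt => ea ec /orP[/eqP e|t0].
  (* A zero trace would force [qa (act W f) = 0]. *)
  by move: ea; rewrite -e sgr0 mul0r mulr0 => /esym/eqP; rewrite mulf_eq0 !gt_eqF.
move: ea ec; rewrite (gtr0_sg t0) !mul1r => ea ec.
exists B; rewrite /nneg_mx; have d := det_SL2ZE B.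
have r0 : 0 < B 1 0 by nia.
have q0 : 0 < B 0 1 by nia.
have ps0 : 0 < B 0 0 * B 1 1 by nia.
have p0 : 0 < B 0 0 by nia.
by split=> //; split; nia.
Qed.

(** The new outer coefficients are the values of [g] at the columns of [A]. *)
Lemma nonneg_form_nneg_mx g (A : 'M[int]_2) : nneg_mx A ->
  0 <= qa g -> 0 <= qb g -> 0 <= qc g ->
  0 <= qa (act_mx A g) /\ 0 <= qc (act_mx A g).
Proof. by case=> *; rewrite /= !addr_ge0 ?mulr_ge0 ?sqr_ge0. Qed.

Lemma nonpos_form_nneg_mx g (A : 'M[int]_2) : nneg_mx A ->
  qa g <= 0 -> qb g <= 0 -> qc g <= 0 ->
  qa (act_mx A g) <= 0 /\ qc (act_mx A g) <= 0.
Proof.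
case=> *; rewrite -oppr_ge0 -[qc _ <= 0]oppr_ge0 /= !opprD -!mulNr.
by rewrite !addr_ge0 ?mulr_ge0 ?sqr_ge0 ?oppr_ge0.
Qed.

(** * The periodic line of forward edges *)

Definition step (W : PSL2Z) : PSL2Z :=
  let g := act W f in
  (W * if (qa g + qb g + qc g < 0)%R then genT else genL)%g.

Lemma step_turn W : turn W (step W).
Proof. by rewrite /turn /step; case: ifP; [left|right]. Qed.

(** The turn [T] puts [g(1,1)] in place of [c], and [L] puts it in place of [a]; [step] takes the
    one that keeps [a > 0 > c]. *)
Lemma step_forward W : forward W -> forward (step W).
Proof.
have [_ _] := nonsquare_act W; rewrite /step /forward.
by case: ifP; rewrite actM ?act_genT ?act_genL;
  case: (act W f) => a b c /= *; split; lia.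
Qed.

Lemma iter_step_forward k W : forward W -> forward (iter k step W).
Proof. by move=> fW; elim: k => //= k /step_forward. Qed.

Lemma step_mulM N W : act N f = f -> step (N * W)%g = (N * step W)%g.
Proof. by move=> fN; rewrite /step actM fN mulgA. Qed.

Lemma iter_step_mulM k N W :
  act N f = f -> iter k step (N * W)%g = (N * iter k step W)%g.
Proof. by move=> fN; elim: k => //= k ->; rewrite step_mulM. Qed.

(* Along the descent the turn peeled off from [B] is the one chosen by [step]:
   a wrong turn would make all coefficients of the form weakly of one sign, and
   nonnegative matrices preserve that. *)
Lemma nneg_mx_steps n (B : SL2Z) W : nneg_mx B -> sum_mx B <= n%:Z ->
  forward W -> forward (W * \pi_PSL2Z B)%g ->
  exists j, (W * \pi_PSL2Z B)%g = iter j step W.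
Proof.
elim: n B W => [|n IHn] B W nB; have [p0 s0] := nneg_mx_diag nB.
  by case: nB; rewrite /sum_mx => *; lia.
move=> sB fW fB; have d := det_SL2ZE B.
have step_case (C : SL2Z) X : nneg_mx C -> sum_mx C <= n%:Z ->
    forward (X * \pi_PSL2Z C)%g -> X = step W ->
    exists j, (X * \pi_PSL2Z C)%g = iter j step W.
  move=> nC sC fC eX; have [|j ->] := IHn C X nC sC _ fC.
    by rewrite eX; apply: step_forward.
  by exists j.+1; rewrite iterSr eX.
have pos_case X (C : SL2Z) : nneg_mx C -> forward (X * \pi_PSL2Z C)%g ->
    ~ (0 <= qa (act X f) /\ 0 <= qb (act X f) /\ 0 <= qc (act X f)).
  move=> nC [_ +] [a0 [b0 c0]]; rewrite actM act_pi.
  by have [_] := nonneg_form_nneg_mx nC a0 b0 c0; lia.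
have neg_case X (C : SL2Z) : nneg_mx C -> forward (X * \pi_PSL2Z C)%g ->
    ~ (qa (act X f) <= 0 /\ qb (act X f) <= 0 /\ qc (act X f) <= 0).
  move=> nC [+ _] [a0 [b0 c0]]; rewrite actM act_pi.
  by have [+ _] := nonpos_form_nneg_mx nC a0 b0 c0; lia.
(* A diagonal [B] is the identity, and no turn is left. *)
have [qr0|qr0] := boolP ((B 0 1 == 0) && (B 1 0 == 0)).
  exists 0%N; rewrite /= -[RHS]mulg1; congr (_ * _)%g.
  move/andP: qr0 => [/eqP q0 /eqP r0]; apply/eq_pi_mxP; left; rewrite !mxE /=.
  by move: d; rewrite q0 r0 => d; split=> //; nia.
(* The rows of [B] are comparable: [T] splits off on the left if the upper one dominates, and [L]
   otherwise. *)
have [le_col|gt_col] := boolP ((B 1 0 <= B 0 0) && (B 1 1 <= B 0 1)).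
  have dC : \det (mx2 (B 0 0 - B 1 0) (B 0 1 - B 1 1) (B 1 0) (B 1 1)) == 1.
    by rewrite det_mx2 -[X in _ == X]d; apply/eqP; ring.
  have eB : \pi_PSL2Z B = (genT * \pi_PSL2Z (MkSL2Z dC))%g.
    rewrite genTE pi_mulg; apply/eq_pi_mxP; left.
    by rewrite !mx_of_SL2ZM !mulmx2E !mxE /=; split; ring.
  have nC : nneg_mx (MkSL2Z dC).
    by case: nB => *; rewrite /nneg_mx !mxE /=; split=> //; lia.
  rewrite eB mulgA in fB *; apply: step_case => //.
    by case: nB => *; rewrite /sum_mx !mxE /=; move: sB; rewrite /sum_mx; lia.
  rewrite /step; case: ifPn => // sg.
  case: (pos_case _ _ nC fB); rewrite actM act_genT.
  by move: fW sg; rewrite /forward; case: (act W f) => a b c /= *; lia.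
have le_col : (B 0 0 <= B 1 0) && (B 0 1 <= B 1 1).
  by case: nB => *; nia.
have dC : \det (mx2 (B 0 0) (B 0 1) (B 1 0 - B 0 0) (B 1 1 - B 0 1)) == 1.
  by rewrite det_mx2 -[X in _ == X]d; apply/eqP; ring.
have eB : \pi_PSL2Z B = (genL * \pi_PSL2Z (MkSL2Z dC))%g.
  rewrite genLE pi_mulg; apply/eq_pi_mxP; left.
  by rewrite !mx_of_SL2ZM !mulmx2E !mxE /=; split; ring.
have nC : nneg_mx (MkSL2Z dC).
  by case: nB => *; rewrite /nneg_mx !mxE /=; split=> //; lia.
rewrite eB mulgA in fB *; apply: step_case => //.
  by case: nB => *; rewrite /sum_mx !mxE /=; move: sB; rewrite /sum_mx; lia.
rewrite /step; case: ifPn => // sg.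
case: (neg_case _ _ nC fB); rewrite actM act_genL.
by move: fW sg; rewrite /forward; case: (act W f) => a b c /= *; lia.
Qed.

Lemma forward_period W : forward W ->
  exists2 L : nat, (0 < L)%N & (M * W)%g = iter L step W.
Proof.
move=> fW; have [B [eB nB r0]] := forward_nneg_mx fW.
have eMW : (M * W)%g = (W * \pi_PSL2Z B)%g by rewrite eB !mulgA mulgV mul1g.
have fMW : forward (W * \pi_PSL2Z B)%g by rewrite -eMW /forward actM act_Mf.
have [|j ej] := @nneg_mx_steps `|sum_mx B|%N B W nB _ fW fMW; first by lia.
exists j; last by rewrite eMW.
(* Zero steps would make [B] plus or minus the identity, against [0 < B 1 0]. *)
rewrite lt0n; apply/eqP => j0; move: ej; rewrite j0 /= -[RHS]mulg1 => /mulgI/eq_pi_mxP.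
by rewrite !mxE /=; case=> -[*]; lia.
Qed.

Lemma act_cyclic_expVn k : act (M ^- k)%g f = f.
Proof. by apply/cyclicE; exists k; right. Qed.

Lemma forward_line W : forward W -> exists E : int -> PSL2Z,
  [/\ E 0 = W, forall n, E (n + 1) = step (E n), forall n, forward (E n)
    & exists2 L : int, 0 < L & forall n, (M * E n)%g = E (n + L)].
Proof.
move=> fW; have [L L0 eL] := forward_period fW.
(* As [step] only moves forward, the edge of index [n] is found [j] periods ahead and translated
   back. By periodicity all [j] with [n + j * L] nonnegative give the same edge. *)
pose F (n : int) (j : nat) := (M ^- j * iter (absz (n + j%:Z * L%:Z)%R) step W)%g.
have FS n j : 0 <= n + j%:Z * L%:Z -> F n j = F n j.+1.
  move=> n0; rewrite /F.
  have -> : absz (n + j.+1%:Z * L%:Z)%R = addn (absz (n + j%:Z * L%:Z)%R) L by nia.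
  by rewrite iterD -eL iter_step_mulM ?act_Mf // expgS invgM -mulgA mulKg.
have FD n j k : 0 <= n + j%:Z * L%:Z -> F n j = F n (j + k)%N.
  move=> n0; elim: k => [|k ->]; first by rewrite addn0.
  by rewrite addnS FS //; nia.
have FE n j j' : 0 <= n + j%:Z * L%:Z -> 0 <= n + j'%:Z * L%:Z -> F n j = F n j'.
  by move=> n0 n0'; rewrite (FD n j j') // (FD n j' j) // addnC.
(* Since [L >= 1], going [|n|] periods ahead is enough. *)
pose E n := F n (absz n).
have EE n j : 0 <= n + j%:Z * L%:Z -> E n = F n j.
  by move=> n0; apply: FE => //; nia.
exists E; split.
- by rewrite /E /F /= invg1 mul1g.
- move=> n; set j := (absz n + absz (n + 1)%R)%N.
  rewrite (EE n j) ?(EE (n + 1) j); try by rewrite /j; nia.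
  rewrite /F step_mulM ?act_cyclic_expVn // -iterS; congr (_ * iter _ _ _)%g.
  by rewrite /j; nia.
- move=> n; rewrite /forward /E /F actM act_cyclic_expVn.
  exact: iter_step_forward.
exists L%:Z => // n; set j := (absz n + absz (n + L%:Z)%R)%N.
(* One more period for [n] than for [n + L] makes the numbers of steps equal. *)
rewrite (EE n j.+1) ?(EE (n + L%:Z) j); try by rewrite /j; nia.
rewrite /F expgSr invgM !mulgA mulgV mul1g; congr (_ * iter (absz _) _ _)%g.
by rewrite -addn1 PoszD; ring.
Qed.

(** * From forward edges to a directed axis *)

Lemma eq_bulletR W : bullet (W * genR)%g = bullet W.
Proof.
apply/seteqP; split=> V; rewrite /bullet /= !expg2 !mulgA ?genRK.
  by case=> [[->|->]|->]; [left; right|right|left; left].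
by case=> [[->|->]|->]; [right|left; left|left; right].
Qed.

Lemma eq_otimesS W : otimes (W * genS)%g = otimes W.
Proof.
apply/seteqP; split=> V; rewrite /otimes /= genSK.
  by case=> ->; [right|left].
by case=> ->; [right|left].
Qed.

Lemma bulletP W V : bullet W V ->
  [\/ V = W, V = (W * genR)%g | V = (W * genR * genR)%g].
Proof.
by rewrite /bullet /= expg2 mulgA => -[[]|] ->; [apply: Or31|apply: Or32|apply: Or33].
Qed.

Lemma int_parity (m : int) : exists n : int, m = 2 * n \/ m = 2 * n + 1.
Proof.
exists (m %/ 2)%Z; have := divz_eq m 2; have := modz_ge0 m (isT : 2 != 0 :> int).
by have := ltz_pmod m (isT : 0 < 2 :> int); lia.
Qed.

Lemma forward_axis W : forward W -> exists2 e, directed_axis M e & e 0 = W.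
Proof.
move=> fW; have [E [E0 ES fE [L L0 EL]]] := forward_line fW.
have turnE n : turn (E n) (E (n + 1)) by rewrite ES; exact: step_turn.
have lt_neq n m : n < m -> E n <> E m.
  move=> lt_nm e; have te k : turn (E (n + k%:Z)) (E (n + k.+1%:Z)).
    by have -> : n + k.+1%:Z = n + k%:Z + 1 by lia.
  have := @turn_no_return (fun k => E (n + k%:Z)) (absz (m - n)) te.
  have -> : n + absz (m - n)%R = m :> int by lia.
  by rewrite addr0 => /(_ (esym e)); lia.
have injE : injective E.
  by move=> n m e; case: (ltgtP n m) => // /lt_neq; rewrite e.
have neS n m : E n <> (E m * genS)%g.
  move=> e; have [a0 _] := fE n; have [_ c0] := fE m.
  by move: a0; rewrite e actM act_genS /= ltNge ltW.
(* [E (n + 1) * genS] is the turn at [E n] without its final [S]: the edge through which the line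
   leaves the bullet-vertex of [E n]. *)
pose e m := if (m %% 2)%Z == 0 then E (m %/ 2)%Z else (E ((m %/ 2)%Z + 1) * genS)%g.
have e_even n : e (2 * n) = E n by rewrite /e modzMr mulKz.
have e_odd n : e (2 * n + 1) = (E (n + 1) * genS)%g.
  by rewrite /e mulrC modzMDl divzMDl //= addr0.
exists e; last by rewrite -[0](mulr0 2) e_even.
split.
- move=> m m'; have [n [] ->] := int_parity m; have [n' [] ->] := int_parity m';
    rewrite ?e_even ?e_odd.
  + by move/injE ->.
  + by move/neS.
  + by move/esym/neS.
  + by move/mulIg/injE/addIr ->.
- move=> n; rewrite e_even e_odd; have [->|->] := turnE n;
    by rewrite /genT /genL !mulgA genSK !eq_bulletR.
- move=> n; have -> : 2 * n + 2 = 2 * (n + 1) by ring.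
  by rewrite e_even e_odd eq_otimesS.
exists (2 * L); first by rewrite mulr_gt0.
move=> m; have [n [] ->] := int_parity m.
  by rewrite -mulrDr !e_even EL.
have -> : 2 * n + 1 + 2 * L = 2 * (n + L) + 1 by ring.
by rewrite !e_odd mulgA EL; congr (E _ * _)%g; ring.
Qed.

(** * Labels along an arbitrary directed axis *)

Section Axis.

Variable e : int -> PSL2Z.
Hypothesis axis_e : directed_axis M e.

Lemma axis_odd n : e (2 * n + 1) = (e (2 * n) * genR)%g \/
                   e (2 * n + 1) = (e (2 * n) * genR * genR)%g.
Proof.
have : bullet (e (2 * n)) (e (2 * n + 1)).
  by rewrite (axis_bullet axis_e); left; left.
by case/bulletP; [move/(axis_inj axis_e); lia|left|right].
Qed.

Lemma axis_even n : e (2 * n + 2) = (e (2 * n + 1) * genS)%g.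
Proof.
have : otimes (e (2 * n + 1)) (e (2 * n + 2)).
  by rewrite (axis_otimes axis_e); left.
by case=> // /(axis_inj axis_e); lia.
Qed.

Lemma axis_turn n : turn (e (2 * n)) (e (2 * (n + 1))).
Proof.
have -> : 2 * (n + 1) = 2 * n + 2 by ring.
by rewrite axis_even; case: (axis_odd n) => ->; [left|right];
  rewrite /genT /genL !mulgA.
Qed.

Lemma genR_neqS : genR <> genS /\ (genR * genR)%g <> genS.
Proof.
split; last rewrite /genR /genS pi_mulg.
  by move/eq_pi_mxP; rewrite !mxE /=; case=> -[].
by move/eq_pi_mxP; rewrite !mx_of_SL2ZM !mulmx2E !mxE /=; case=> -[].
Qed.

(** For odd [l], [M] would carry a passage through a bullet-vertex to one through an otimes-vertex,
    so that [R] or [R ^ 2] would equal [S]. *)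
Lemma axis_transl_even : exists2 l : int, 0 < l &
  forall n, (M * e (2 * n))%g = e (2 * (n + l)).
Proof.
have [l l0 el] := axis_transl axis_e.
have [k [] lk] := int_parity l.
  by exists k; [lia|move=> n; rewrite el lk -mulrDr].
have := el (2 * 0 + 1); have := axis_even k.
have -> : 2 * 0 + 1 + l = 2 * k + 2 by lia.
have -> : 2 * k + 1 = 2 * 0 + l by lia.
rewrite -el => ->; have [neR neRR] := genR_neqS.
by case: (axis_odd 0) => ->; rewrite -!mulgA => /mulgI/mulgI // /esym.
Qed.

(** The axis goes from [e (2 * n)] to its image under [M] by turns only, so the conjugate of [M] by
    this edge has a nonnegative matrix. *)
Lemma axis_forward n : forward (e (2 * n)).
Proof.
have [l l0 el] := axis_transl_even.
have te (k : nat) : turn (e (2 * (n + k%:Z))) (e (2 * (n + k.+1%:Z))).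
  by have -> : n + k.+1%:Z = n + k%:Z + 1; [lia|exact: axis_turn].
have [B [eB nB _]] := @turn_word (fun k : nat => e (2 * (n + k%:Z))) (absz l) te.
apply: nneg_mx_forward nB; apply: (mulgI (e (2 * n))).
move: eB; rewrite gez0_abs ?ltW // -el addr0 => <-.
by rewrite !mulgA mulgV mul1g.
Qed.

(** The next entering edge is forward too, and [g(1,1)] is its last coefficient after [T] and its
    first after [L]. *)
Lemma axis_sum n : let g := act (e (2 * n)) f in
  (qa g + qb g + qc g < 0 /\ e (2 * n + 1) = (e (2 * n) * genR)%g) \/
  (0 < qa g + qb g + qc g /\ e (2 * n + 1) = (e (2 * n) * genR * genR)%g).
Proof.
have [] := axis_forward (n + 1); have -> : 2 * (n + 1) = 2 * n + 2 by ring.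
rewrite axis_even; case: (axis_odd n) => -> a0 c0; [left|right]; split=> //.
  by move: c0; rewrite !actM act_genS !act_genR.
by move: a0; rewrite !actM act_genS !act_genR; case: (act _ f) => a b c /=; lia.
Qed.

End Axis.

(** If the axis turns by [R], the third edge is the outgoing one times [R], on its right; if by
    [R ^ 2], it is the outgoing one times [R ^ 2], on its left. *)
Lemma branch_side e n Z : directed_axis M e ->
    bullet (e (2 * n)) Z -> Z <> e (2 * n) -> Z <> e (2 * n + 1) ->
  let g := act (e (2 * n)) f in
  let y := 'Im (edge_dir Z / edge_dir (e (2 * n + 1))) in
  (0 < y <-> 0 < qa g + qb g + qc g) /\ (y < 0 <-> qa g + qb g + qc g < 0).
Proof.
move=> ae /bulletP bZ neZ0 neZ1; have [[sg eX]|[sg eX]] := axis_sum ae n.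
  have -> : Z = (e (2 * n + 1) * genR)%g.
    by case: bZ neZ0 neZ1 => -> //; rewrite eX.
  have yl := edge_dirR_right (e (2 * n + 1)).
  by rewrite /= yl sg (lt_gtF yl) (lt_gtF sg).
have -> : Z = (e (2 * n + 1) * genR * genR)%g.
  by case: bZ neZ0 neZ1 => ->; rewrite eX // genRK.
have yl := edge_dirRR_left (e (2 * n + 1)).
by rewrite /= yl sg (lt_gtF yl) (lt_gtF sg).
Qed.

(** * Spine, branches and reduced edges in the quotient *)

Lemma cark_vertexP v v' : cark_vertex M v = cark_vertex M v' ->
  exists2 N, act N f = f & v = [set (N * W)%g | W in v'].
Proof.
have c1 : cyclic_subgroup M 1%g by exists 0%N; left.
move=> e; have : cark_vertex M v v.
  exists 1%g => //; apply/seteqP; split=> [W [V vV <-]|W vW].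
    by rewrite mul1g.
  by exists W => //; rewrite mul1g.
by rewrite e => -[N /cyclicE fN <-]; exists N.
Qed.

(** The powers of [M] form the whole stabilizer of [f]. This makes the labelling both well defined
    and injective. *)
Lemma cark_edgeP W W' : cark_edge M W = cark_edge M W' <-> act W f = act W' f.
Proof.
have sub V V' : act V f = act V' f -> cark_edge M V `<=` cark_edge M V'.
  move=> e _ [N /cyclicE fN <-]; exists (N * V * V'^-1)%g.
    by apply/cyclicE; rewrite !actM fN e actKV.
  by rewrite mulgVK.
split=> [e|e]; last by apply/seteqP; split; apply: sub.
have : cark_edge M W W.
  by exists 1%g; [exists 0%N; left|rewrite mul1g].
by rewrite e => -[N /cyclicE fN <-]; rewrite actM fN.
Qed.

(** Multiplication by [R] puts [a > 0] last, and by [R ^ 2] puts [c < 0] first. So a bullet-vertex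
    determines the edge through which an axis enters it. *)
Lemma forward_bullet U V : forward U -> forward V -> bullet U V -> V = U.
Proof.
move=> fU fV /bulletP[] // eV; move: fU fV; rewrite eV /forward !actM !act_genR;
  by case: (act U f) => a b c /=; lia.
Qed.

Definition on_spine W : Prop := qa (act W f) * qc (act W f) < 0.

Lemma forward_or_back W : on_spine W -> forward W \/ forward (W * genS)%g.
Proof.
rewrite /on_spine /forward actM act_genS; case: (act W f) => a b c /=.
case: (ltgtP 0 a) => [a0|a0|<-]; last by rewrite mul0r.
  by rewrite pmulr_rlt0 //; left.
by rewrite nmulr_rlt0 //; right.
Qed.

Lemma on_spineS W : on_spine W -> on_spine (W * genS)%g.
Proof. by rewrite /on_spine actM act_genS /= mulrC. Qed.

(* The form [g] attached to an edge takes the values [g(1,0)], [g(0,1)] and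
   [g(1,1)] on the three regions around the bullet-end of that edge; the branch
   there separates two regions on the same side of the axis. *)
Lemma forward_of_bullet W : on_spine W ->
  exists U, [/\ forward U, bullet U = bullet W &
    let g := act W f in let h := act U f in
    (0 < qa h + qb h + qc h <-> 0 < qa g + qb g + qc g) /\
    (qa h + qb h + qc h < 0 <-> qa g + qb g + qc g < 0)].
Proof.
move=> /forward_or_back[fW|]; first by exists W.
have [_ _] := nonsquare_act W; rewrite /forward actM act_genS.
(* Here the axis leaves through [W], and [a < 0 < c]. With [s = a + b + c], the other two edges have
   outer coefficients [(s, a)] and [(c, s)]; the sign of [s] tells which one is forward. *)
move=> sg fWS; have [s0|s0] := ltP 0 (qa (act W f) + qb (act W f) + qc (act W f)).
  exists (W * genR)%g; rewrite eq_bulletR actM act_genR.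
  by move: fWS s0 sg; case: (act W f) => a b c /= *; split=> //; lia.
exists (W * genR * genR)%g; rewrite !eq_bulletR !actM !act_genR.
by move: fWS s0 sg; case: (act W f) => a b c /= *; split=> //; lia.
Qed.

(** The lift chosen in [branch_at] may be a translate of [bullet U]; by [forward_bullet] its
    entering edge is then a translate of [U], with the same label. *)
Lemma branch_at_forward U X Z : forward U ->
  branch_at M (cark_vertex M (bullet U)) X Z -> exists e n,
  [/\ directed_axis M e, act (e (2 * n)) f = act U f, X = e (2 * n + 1)
    & [/\ bullet (e (2 * n)) Z, Z <> e (2 * n) & Z <> e (2 * n + 1)]].
Proof.
move=> fU [e [n [ae /cark_vertexP[N fN eU] eX hZ]]]; exists e, n; split=> //.
rewrite -(@forward_bullet U (N * e (2 * n)%R)%g fU) ?actM ?fN //.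
  by rewrite /forward actM fN; exact: axis_forward.
by rewrite eU; exists (e (2 * n)) => //; left; left.
Qed.

Lemma forward_branch_at U : forward U ->
  exists X Z, branch_at M (cark_vertex M (bullet U)) X Z.
Proof.
move=> /forward_axis[e ae e0].
have [Z bZ] : exists Z, [/\ bullet (e (2 * 0)) Z, Z <> e (2 * 0) & Z <> e (2 * 0 + 1)].
  have neR V : V <> (V * genR)%g.
    rewrite -[V in V <> _]mulg1 => /mulgI/eq_pi_mxP.
    by rewrite !mxE /=; case=> -[].
  have neRR V : V <> (V * genR * genR)%g.
    by move=> eV; apply: (neR V); rewrite [in RHS]eV genRK.
  case: (axis_odd ae 0) => ->.
    exists (e (2 * 0)%R * genR * genR)%g; split; last exact/nesym/neR.
    - by right; rewrite expg2 mulgA.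
    - exact/nesym/neRR.
  exists (e (2 * 0)%R * genR)%g; split; last exact: neR.
  - by left; right.
  - exact/nesym/neR.
by exists (e (2 * 0 + 1)), Z, e, 0; split=> //; rewrite mulr0 e0.
Qed.

(** By [branch_side] the side is the same for every axis and lift, and [forward_branch_at] supplies
    one. *)
Lemma branch_sum W : on_spine W -> let g := act W f in
  (branch_inner M (cark_vertex M (bullet W)) <-> 0 < qa g + qb g + qc g) /\
  (branch_outer M (cark_vertex M (bullet W)) <-> qa g + qb g + qc g < 0).
Proof.
move=> /forward_of_bullet[U [fU <- /= [<- <-]]].
have side X Z : branch_at M (cark_vertex M (bullet U)) X Z ->
    let h := act U f in let y := 'Im (edge_dir Z / edge_dir X) in
    (0 < y <-> 0 < qa h + qb h + qc h) /\ (y < 0 <-> qa h + qb h + qc h < 0).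
  move=> /(branch_at_forward fU)[e [n [ae <- -> [bZ Z0 Z1]]]].
  exact: branch_side.
have [X [Z bXZ]] := forward_branch_at fU; have [s1 s2] := side X Z bXZ.
split; split.
- by move=> [X' [Z' [/side[s' _] /s']]].
- by move=> /s1; exists X, Z.
- by move=> [X' [Z' [/side[_ s'] /s']]].
- by move=> /s2; exists X, Z.
Qed.

Lemma spine_edgeP W : spine_edge M (cark_edge M W) <-> on_spine W.
Proof.
split=> [[e [m [ae /cark_edgeP eW]]]|].
  rewrite /on_spine eW; have [n [] ->] := int_parity m.
    by have [a0 c0] := axis_forward ae n; rewrite pmulr_rlt0.
  have := axis_forward ae (n + 1).
  have -> : 2 * (n + 1) = 2 * n + 2 by ring.
  rewrite (axis_even ae) /forward actM act_genS /= => -[c0 a0].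
  by rewrite nmulr_rlt0.
move=> /forward_or_back[] /forward_axis[e ae e0]; first by exists e, 0; rewrite e0.
(* Index [0] holds [W * genS], so [W] is the edge before it, at the odd index [-1]. *)
exists e, (2 * (-1) + 1); split=> //; congr (cark_edge M _).
apply: (mulIg genS); rewrite -e0 -(axis_even ae); congr e; ring.
Qed.

(** The other edge at the otimes-vertex is [W * genS], for which [g(1,1)] becomes [g(1,-1)]. *)
Lemma reduced_edgeP W : let g := act W f in
  reduced_edge M (cark_edge M W) <->
  [/\ qa g * qc g < 0, 0 < qa g + qb g + qc g & qa g - qb g + qc g < 0].
Proof.
have sumS V : let h := act (V * genS)%g f in let g := act V f in
    qa h + qb h + qc h = qa g - qb g + qc g.
  by move=> h g; rewrite /h actM act_genS /g; case: (act V f) => a b c /=; ring.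
split.
  case=> /spine_edgeP sW [t [v [E' [v' []]]]].
  move=> [W1 [/cark_edgeP e1 -> ->]] inn [spE' neE'] [W2 [eE' et ->]] out.
  have s1 : on_spine W1 by rewrite /on_spine -e1.
  have s2 : on_spine W2 by apply/spine_edgeP; rewrite -eE'.
  have [i1 _] := branch_sum s1; have [_ o2] := branch_sum s2.
  move/i1: inn; move/o2: out; rewrite e1 -(sumS W1) => o i; split=> //.
  have [N fN eN] := cark_vertexP et.
  have : otimes W1 (N * W2)%g by rewrite eN; exists W2 => //; left.
  have actN : act (N * W2)%g f = act W2 f by rewrite actM fN.
  (* If the second edge were a translate of [W1] itself, then [E'] would be the given edge. *)
  case=> e2; rewrite e2 in actN; last by rewrite actN.
  by case: neE'; rewrite eE'; apply/(cark_edgeP W2 W); rewrite e1.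
case=> sW inn; rewrite -sumS => out.
have sWS := on_spineS sW; split; first exact/spine_edgeP.
exists (cark_vertex M (otimes W)), (cark_vertex M (bullet W)).
exists (cark_edge M (W * genS)%g), (cark_vertex M (bullet (W * genS)%g)); split.
- by exists W.
- by apply/(branch_sum sW).1.
- split; first exact/spine_edgeP.
  by move=> /cark_edgeP e; move: out; rewrite e ltNge ltW.
- by exists (W * genS)%g; rewrite eq_otimesS.
- by apply/(branch_sum sWS).2.
Qed.

End Form.

(** * Gauss' condition as inequalities between integers *)

Lemma ltr_int_sqrtC (d n : int) : 0 <= d ->
  (n%:~R < sqrtC d%:~R :> algC) = (n < 0) || (n ^+ 2 < d).
Proof.
move=> d0; have s0 : 0 <= sqrtC d%:~R :> algC by rewrite sqrtC_ge0 ler0z.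
have [n0|n0] := ltP n 0; first by rewrite (lt_le_trans _ s0) ?ltrz0.
by rewrite -ltr_sqr ?nnegrE ?ler0z // sqrtCK -rmorphXn /= ltr_int.
Qed.

Lemma ltr_sqrtC_int (d n : int) : 0 <= d ->
  (sqrtC d%:~R < n%:~R :> algC) = (0 <= n) && (d < n ^+ 2).
Proof.
move=> d0; have s0 : 0 <= sqrtC d%:~R :> algC by rewrite sqrtC_ge0 ler0z.
have [n0|n0] := leP 0 n; last by rewrite (lt_gtF (lt_le_trans _ s0)) ?ltrz0.
by rewrite -ltr_sqr ?nnegrE ?ler0z // sqrtCK -rmorphXn /= ltr_int.
Qed.

(** For [a > 0], subtracting [d] from the three squares leaves [4a(a - b + c)], [4a(a + b + c)] and
    [4ac]. *)
Lemma gauss_ineq (a b c : int) (d := b ^+ 2 - 4 * a * c) :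
  ((2 * `|a| - b < 0) || ((2 * `|a| - b) ^+ 2 < d)) &&
  ((0 <= b + 2 * `|a|) && (d < (b + 2 * `|a|) ^+ 2)) &&
  ((b < 0) || (b ^+ 2 < d)) <->
  [/\ a * c < 0, 0 < a + b + c & a - b + c < 0].
Proof.
(* Negating [a] and [c] preserves [d] and exchanges the last two conditions on the right. *)
wlog a0 : a b c @d / 0 <= a.
  move=> wl; have [|a0] := leP 0 a; first exact: wl.
  have := wl (- a) b (- c); rewrite normrN oppr_ge0 (ltW a0) mulrNN.
  have -> : b ^+ 2 - 4 * - a * - c = d by rewrite /d; ring.
  move=> /(_ isT) ->; split=> -[]; split=> //; lia.
rewrite (ger0_norm a0) {}/d; split.
  move=> /andP[/andP[h1 /andP[h2 h3]] h4].
  have b0 : 0 < b by nia.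
  have ac : a * c < 0 by nia.
  have a1 : 0 < a by nia.
  by split=> //; nia.
move=> [ac h1 h2].
have a1 : 0 < a by nia.
have b0 : 0 < b by nia.
by nia.
Qed.

Lemma gauss_reducedP g : 0 < disc g ->
  gauss_reduced g <->
  [/\ qa g * qc g < 0, 0 < qa g + qb g + qc g & qa g - qb g + qc g < 0].
Proof.
case: g => a b c d0; rewrite /gauss_reduced /=.
have sR : sqrtC (disc (QForm a b c))%:~R \is @Num.real algC.
  by rewrite ger0_real // sqrtC_ge0 ler0z ltW.
have aE : 2 * `|a%:~R| = (2 * `|a|)%:~R :> algC.
  by rewrite rmorphM /= intr_norm.
rewrite aE real_ltr_norml ?rpredB ?realz //.
have -> s : (- b%:~R < s - (2 * `|a|)%:~R :> algC) = ((2 * `|a| - b)%:~R < s).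
  by rewrite ltrBrDr rmorphB /= addrC.
rewrite ltrBlDr -rmorphD /= !ltr_int_sqrtC ?ltr_sqrtC_int ?(ltW d0) //.
exact: gauss_ineq.
Qed.

Theorem theorem4p4 (f : qform) (f_indef : 0 < disc f)
    (f_nonsq : ~ exists n : int, disc f = n ^+ 2)
    (M : PSL2Z) (hM : is_Mf f M) :
  exists2 label : set PSL2Z -> qform,
    forall W : PSL2Z, label (cark_edge M W) = act W f &
    set_bij [set E | reduced_edge M E]
            [set g | qclass f g /\ gauss_reduced g] label.
Proof.
(* Any representative of the orbit gives the same label by [cark_edgeP]; the default [1] arises only
   for sets that are no edges of the quotient. *)
pose label (E : set PSL2Z) := act (xget 1%g [set W | E = cark_edge M W]) f.
have labelE W : label (cark_edge M W) = act W f.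
  rewrite /label; case: xgetP => [V _ /esym/(cark_edgeP hM)//|/(_ W)].
  by case.
exists label => //; split.
- move=> E rE; have [[e [n [_ eE]]] _] := rE; move: rE; rewrite eE /= labelE.
  move=> /(reduced_edgeP f_nonsq hM) r; split; first by exists (e n).
  by apply/gauss_reducedP; rewrite ?disc_act.
- move=> E E' /set_mem[[e [n [_ ->]]] _] /set_mem[[e' [n' [_ ->]]] _].
  by rewrite !labelE => /(cark_edgeP hM).
move=> g [[W _ <-] gW]; exists (cark_edge M W); rewrite ?labelE //=.
by apply/(reduced_edgeP f_nonsq hM)/gauss_reducedP; rewrite ?disc_act.
Qed.
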